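(* Let $E$ be a set of $n$ points in $\mathbb{R}^3$. The number of tuples $(x_1,x_2,x_3,x_4)\in E^4$ with $\angle(x_1,x_2,x_3)=\angle(x_2,x_3,x_4)=\pi/2$ and such that the line through $x_1,x_2$ is parallel to the line through $x_3,x_4$ is $\lesssim n^3$.
   Context: $\angle(x,y,z)\in[0,\pi]$ denotes the angle at $y$ between $x-y$ and $z-y$ (for $x\ne y\ne z$). $X\lesssim Y$ means $X\le CY$ for all $n>N$ with constants $C,N$ independent of $n$. *)

(* Defs.v *)
From mathcomp Require Import all_boot all_order all_algebra.
From mathcomp Require Import finmap.
From mathcomp Require Import boolp classical_sets reals trigo.

Set Implicit Arguments.
Unset Strict Implicit.
Unset Printing Implicit Defensive.

Import Order.TTheory GRing.Theory Num.Theory.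
Local Open Scope ring_scope.

Definition dotv (R : realType) (d : nat) (u v : 'rV[R]_d) : R :=
  \sum_i u 0 i * v 0 i.

(* The norm that MathComp-Analysis puts on 'rV[R]_d is the max norm, hence
   this separate Euclidean norm. *)
Definition enorm (R : realType) (d : nat) (u : 'rV[R]_d) : R :=
  Num.sqrt (dotv u u).

(* Meaningful only when x <> y and z <> y: otherwise the quotient is 0 by
   convention and the value is the junk value pi / 2, so that any statement
   about angles must carry these two conditions. *)
Definition angle (R : realType) (d : nat) (x y z : 'rV[R]_d) : R :=
  acos (dotv (x - y) (z - y) / (enorm (x - y) * enorm (z - y))).

Definition has_angle (R : realType) (d : nat) (x y z : 'rV[R]_d) (a : R)
  : Prop :=
  [/\ x != y, z != y & angle x y z = a].

Definition line_through (R : realType) (d : nat) (x y : 'rV[R]_d)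
  : set 'rV[R]_d :=
  [set p | exists t : R, p = x + t *: (y - x)]%classic.

(* Lines are parallel when one is a translate of the other; in particular a
   line is parallel to itself. *)
Definition parallel (R : realType) (d : nat) (L M : set 'rV[R]_d) : Prop :=
  exists v : 'rV[R]_d, M = [set p + v | p in L]%classic.

Definition right_parallel_tuple (R : realType) (x1 x2 x3 x4 : 'rV[R]_3)
  : Prop :=
  [/\ has_angle x1 x2 x3 (pi / 2),
      has_angle x2 x3 x4 (pi / 2)
    & parallel (line_through x1 x2) (line_through x3 x4)].

(* E, coerced to a finite type, is the type of its elements. *)
Definition right_parallel_tuples (R : realType) (E : {fset 'rV[R]_3})
  : {set E * E * E * E} :=
  [set t : E * E * E * E |
    let: (x1, x2, x3, x4) := t in
    `[< right_parallel_tuple (val x1) (val x2) (val x3) (val x4) >] ].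

(* Main.v *)
Require Import Defs.
From mathcomp Require Import all_boot all_order all_algebra.
From mathcomp Require Import finmap.
From mathcomp Require Import reals.
From mathcomp Require Import boolp trigo ring.

(** The triple (x1, x2, x4) determines x3: the lines being parallel, x3 lies on
the line through x4 directed by x2 - x1, and the right angle at x2 makes x3 the
orthogonal projection of x2 onto that line. Hence there are at most n^3 tuples. *)

Import Order.TTheory GRing.Theory Num.Theory.
Local Open Scope ring_scope.

Section DotProduct.
Context {R : realType} {d : nat}.
Implicit Types (u v w x y z : 'rV[R]_d) (a : R).

Lemma dotvC u v : dotv u v = dotv v u.
Proof. by apply: eq_bigr => i _; rewrite mulrC. Qed.

Lemma dotvBr u v w : dotv u (v - w) = dotv u v - dotv u w.
Proof. by rewrite -sumrB; apply: eq_bigr => i _; rewrite !mxE mulrBr. Qed.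

Lemma dotvZr a u v : dotv u (a *: v) = a * dotv u v.
Proof. by rewrite mulr_sumr; apply: eq_bigr => i _; rewrite !mxE mulrCA. Qed.

Lemma dotvv_ge0 u : 0 <= dotv u u.
Proof. by apply: sumr_ge0 => i _; rewrite -expr2 sqr_ge0. Qed.

Lemma dotvv_eq0 u : (dotv u u == 0) = (u == 0).
Proof.
have sq_ge0 i : true -> 0 <= u 0 i * u 0 i by rewrite -expr2 sqr_ge0.
apply/eqP/eqP => [u0|->]; last by apply: big1 => i _; rewrite mxE mul0r.
apply/rowP => i; apply/eqP; rewrite mxE -sqrf_eq0 expr2.
exact/eqP/(psumr_eq0P sq_ge0 u0).
Qed.

(** For [v != 0], the square norm of [dotv v v *: u - dotv u v *: v] is nonnegative and equals
    [dotv v v] times the difference of the two sides. *)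
Lemma dotv_cauchy_schwarz u v : dotv u v ^+ 2 <= dotv u u * dotv v v.
Proof.
have [->|v0] := eqVneq v 0.
  have w0 w : dotv w (0 : 'rV[R]_d) = 0 by apply: big1 => i _; rewrite mxE mulr0.
  by rewrite !w0 mulr0 expr0n.
have vv : 0 < dotv v v by rewrite lt_def dotvv_eq0 v0 dotvv_ge0.
have := dotvv_ge0 (dotv v v *: u - dotv u v *: v).
rewrite dotvBr !dotvZr ![dotv (_ - _) _]dotvC !dotvBr !dotvZr (dotvC v u).
have -> : dotv v v * (dotv v v * dotv u u - dotv u v * dotv u v) -
  dotv u v * (dotv v v * dotv u v - dotv u v * dotv v v) =
  dotv v v * (dotv u u * dotv v v - dotv u v ^+ 2) by ring.
by rewrite pmulr_rge0// subr_ge0.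
Qed.

Lemma has_angle_pihalf x y z :
  has_angle x y z (pi / 2) -> dotv (x - y) (z - y) = 0.
Proof.
rewrite /has_angle /angle /enorm -[x == y]subr_eq0 -[z == y]subr_eq0.
move: (x - y) (z - y) => u v [u0 v0].
have uu : 0 < dotv u u by rewrite lt_def dotvv_eq0 u0 dotvv_ge0.
have vv : 0 < dotv v v by rewrite lt_def dotvv_eq0 v0 dotvv_ge0.
rewrite -sqrtrM ?dotvv_ge0//; set s := Num.sqrt _ => acosE.
have s0 : 0 < s by rewrite sqrtr_gt0 mulr_gt0.
(* [acos] is inverted by [cos] only on [-1, 1]; Cauchy-Schwarz, after taking square roots, puts the
   quotient there. *)
have le1 : -1 <= dotv u v / s <= 1.
  rewrite -ler_norml normf_div (gtr0_norm s0) ler_pdivrMr// mul1r.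
  by rewrite -sqrtr_sqr ler_wsqrtr// dotv_cauchy_schwarz.
have /eqP := acosK le1; rewrite acosE cos_pihalf eq_sym mulf_eq0 invr_eq0.
by rewrite (gt_eqF s0) orbF => /eqP.
Qed.

(** Both [z] and [w] are translates by the same [v] of points of the line through [x] and [y], so
    [v] cancels in [w - z]. *)
Lemma parallel_line_through x y z w :
  parallel (line_through x y) (line_through z w) ->
  exists t, w - z = t *: (y - x).
Proof.
move=> [v lineE].
have : line_through z w z by exists 0; rewrite scale0r addr0.
have : line_through z w w by exists 1; rewrite scale1r addrC subrK.
rewrite lineE => -[_ [s ->] <-] [_ [t ->] <-]; exists (s - t).
by rewrite scalerBl 2!opprD addrACA subrr addr0 addrACA subrr add0r.
Qed.

End DotProduct.

(** The vector [x3 - y3] is a multiple of [x1 - x2] by parallelism and orthogonal to it by the right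
    angles at [x2]. As [x1 != x2], it vanishes. *)
Lemma right_parallel_tuple_inj3 (R : realType) (x1 x2 x3 y3 x4 : 'rV[R]_3) :
  right_parallel_tuple x1 x2 x3 x4 -> right_parallel_tuple x1 x2 y3 x4 ->
  x3 = y3.
Proof.
move=> [ang3 _ /parallel_line_through[s s4]].
move=> [/has_angle_pihalf angy _ /parallel_line_through[t t4]].
have [/negP x12 _ _] := ang3; move/has_angle_pihalf: ang3 => ang3.
have diffE : x3 - y3 = (s - t) *: (x1 - x2).
  rewrite -[x1 - x2]opprB scalerN scalerBl -s4 -t4.
  by rewrite 2!opprB [RHS]addrC addrA subrK.
have : dotv (x1 - x2) (x3 - y3) = 0.
  have -> : x3 - y3 = (x3 - x2) - (y3 - x2) by rewrite opprB addrA subrK.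
  by rewrite dotvBr ang3 angy subrr.
rewrite diffE dotvZr => /eqP; rewrite mulf_eq0 dotvv_eq0 [x1 - _ == 0]subr_eq0.
case/orP => // /eqP st0; apply/eqP.
by rewrite -subr_eq0 diffE st0 scale0r.
Qed.

Theorem theorem4p3 (R : realType) :
  exists (C : R) (N : nat), forall (n : nat) (E : {fset 'rV[R]_3}),
    (N < n)%N -> #|` E|%fset = n ->
    (#|right_parallel_tuples E|)%:R <= C * n%:R ^+ 3.
Proof.
(* The bound is exactly [n ^ 3], so the constant 1 suffices, and the inequality can be proved
   between natural numbers. *)
exists 1, 0%N => n E _ En; rewrite mul1r -natrX ler_nat.
pose drop3 (t : E * E * E * E) := (t.1.1.1, t.1.1.2, t.2).
have drop3_inj : {in right_parallel_tuples E &, injective drop3}.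
  move=> [[[x1 x2] x3] x4] [[[y1 y2] y3] y4].
  rewrite !inE => /asboolP tx /asboolP ty [e1 e2 e4].
  rewrite -{}e1 -{}e2 -{}e4 in ty *.
  by rewrite (val_inj (right_parallel_tuple_inj3 _ _ _ _ _ _ tx ty)).
(* The image under [drop3] has as many elements as the set of tuples and lies in [E * E * E]. *)
rewrite -(card_in_imset drop3_inj); apply: leq_trans (max_card _) _.
by rewrite !card_prod -cardfE En -!mulnA expnS expnS expn1.
Qed.
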